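(* Let $r,k\in\mathbb{Z}$ and let $n,m$ be integers with $n-1\ge m\ge 1$. Then $$\begin{aligned}&\sum_{l=0}^{n-m}\binom{n}{l}S_{1}(n-l,m)A_{l}^{(r,k)}\\&=r\sum_{l=0}^{n-1-m}\sum_{a=0}^{l}(-1)^{l-a+1}\frac{(l-a)!}{l-a+2}\binom{n-1}{l}\binom{l}{a}S_{1}(n-1-l,m)A_{a}^{(r+1,k)}(1)\\&\quad+r\sum_{l=0}^{n-1-m}\binom{n-1}{l}S_{1}(n-l-1,m)A_{l}^{(r,k)}(1)\\&\quad+\frac{1}{m}\sum_{l=0}^{n-m}\binom{n-1}{l}S_{1}(n-l-1,m-1)A_{l}^{(r,k-1)}(1)\\&\quad+\left(1-\frac{1}{m}\right)\sum_{l=0}^{n-m}\binom{n-1}{l}S_{1}(n-l-1,m-1)A_{l}^{(r,k)}(1).\end{aligned}$$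
   Context: All generating functions are formal power series in $t$. For $k\in\mathbb{Z}$, put $\mathrm{Lif}_k(t)=\sum_{n\ge 0}\frac{t^n}{n!(n+1)^k}$. For $r,k\in\mathbb{Z}$, the polynomials $A_n^{(r,k)}(x)\in\mathbb{C}[x]$ are defined by $$\left(\frac{t}{\log(1+t)}\right)^{r}\frac{\mathrm{Lif}_k(\log(1+t))}{(1+t)^{x}}=\sum_{n\ge 0}A_n^{(r,k)}(x)\frac{t^n}{n!},$$ and $A_n^{(r,k)}=A_n^{(r,k)}(0)$. $S_1(n,m)$ is the (signed) Stirling number of the first kind: $x(x-1)\cdots(x-n+1)=\sum_{m=0}^n S_1(n,m)x^m$ (with $S_1(0,0)=1$). *)

(* Defs.v *)
From HB Require Import structures.
From mathcomp Require Import all_boot all_order all_algebra.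
From mathcomp Require Import boolp reals complex.
Set Implicit Arguments.
Unset Strict Implicit.
Unset Printing Implicit Defensive.
Import Order.TTheory GRing.Theory Num.Theory.
Local Open Scope ring_scope.

(** Formal power series in [t] over [R]; the one-field record keeps the Cauchy
    product apart from the pointwise ring structure of [nat -> R]. *)
Record fps (R : Type) := Fps { coefs : nat -> R }.

HB.instance Definition _ (R : Type) := [isNew for @coefs R].
HB.instance Definition _ (R : choiceType) := [Choice of fps R by <:].

Lemma fpsP (R : Type) (f g : fps R) : coefs f =1 coefs g <-> f = g.
Proof.
by split=> [|-> //]; case: f g => [f] [g] /= /funext ->.
Qed.

Section Zmodule.
Variable R : zmodType.
Implicit Types f g h : fps R.

Definition fps_zero : fps R := Fps (fun=> 0).
Definition fps_opp f : fps R := Fps (fun n => - coefs f n).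
Definition fps_add f g : fps R := Fps (fun n => coefs f n + coefs g n).

Fact fps_addA : associative fps_add.
Proof. by move=> f g h; apply/fpsP => n /=; rewrite addrA. Qed.
Fact fps_addC : commutative fps_add.
Proof. by move=> f g; apply/fpsP => n /=; rewrite addrC. Qed.
Fact fps_add0 : left_id fps_zero fps_add.
Proof. by move=> f; apply/fpsP => n /=; rewrite add0r. Qed.
Fact fps_addN : left_inverse fps_zero fps_opp fps_add.
Proof. by move=> f; apply/fpsP => n /=; rewrite addNr. Qed.

HB.instance Definition _ :=
  GRing.isZmodule.Build (fps R) fps_addA fps_addC fps_add0 fps_addN.

Lemma coefs0 n : coefs (0 : fps R) n = 0. Proof. by []. Qed.
Lemma coefsN f n : coefs (- f) n = - coefs f n. Proof. by []. Qed.
Lemma coefsD f g n : coefs (f + g) n = coefs f n + coefs g n.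
Proof. by []. Qed.
Lemma coefsB f g n : coefs (f - g) n = coefs f n - coefs g n.
Proof. by []. Qed.
Lemma coefs_sum (I : Type) (s : seq I) (P : pred I) (F : I -> fps R) n :
  coefs (\sum_(i <- s | P i) F i) n = \sum_(i <- s | P i) coefs (F i) n.
Proof. exact: (big_morph (fun f => coefs f n)). Qed.

End Zmodule.

Section ComRing.
Variable R : comNzRingType.
Implicit Types f g h : fps R.

Definition fps_one : fps R := Fps (fun n => (n == 0)%N%:R).
Definition fps_mul f g : fps R :=
  Fps (fun n => \sum_(i < n.+1) coefs f i * coefs g (n - i)%N).

Definition fps_trunc N f : {poly R} := \poly_(i < N) coefs f i.

Lemma coefs_mul_trunc N f g n : (n < N)%N ->
  coefs (fps_mul f g) n = (fps_trunc N f * fps_trunc N g)`_n.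
Proof.
move=> nN; rewrite coefM; apply: eq_bigr => i _.
have iN : (i < N)%N by apply: leq_trans nN; apply: ltn_ord.
by rewrite !coef_poly iN (leq_ltn_trans (leq_subr _ _) nN).
Qed.

Fact fps_mulC : commutative fps_mul.
Proof.
by move=> f g; apply/fpsP => n; rewrite !(@coefs_mul_trunc n.+1) // mulrC.
Qed.

Fact fps_mulA : associative fps_mul.
Proof.
move=> f g h; apply/fpsP => n.
pose T := fps_trunc n.+1.
transitivity ((T f * (T g * T h))`_n).
  rewrite (@coefs_mul_trunc n.+1) // !coefM; apply: eq_bigr => i _.
  by rewrite [X in _ * X]coef_poly ltnS leq_subr (@coefs_mul_trunc n.+1) ?ltnS
             ?leq_subr.
rewrite mulrA (@coefs_mul_trunc n.+1) // !coefM; apply: eq_bigr => i _.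
by rewrite [X in _ = X * _]coef_poly ltn_ord (@coefs_mul_trunc n.+1).
Qed.

Fact fps_mul1 : left_id fps_one fps_mul.
Proof.
move=> f; apply/fpsP => n /=; rewrite big_ord_recl /= mul1r subn0 big1 ?addr0 //.
by move=> i _; rewrite mul0r.
Qed.

Fact fps_mulD : left_distributive fps_mul (@fps_add R).
Proof.
move=> f g h; apply/fpsP => n /=; rewrite -big_split /=.
by apply: eq_bigr => i _; rewrite mulrDl.
Qed.

Fact fps_one_neq0 : fps_one != 0.
Proof.
by apply/eqP => /(congr1 (fun f => coefs f 0)) /eqP; rewrite oner_eq0.
Qed.

HB.instance Definition _ := GRing.Zmodule_isComNzRing.Build (fps R)
  fps_mulA fps_mulC fps_mul1 fps_mulD fps_one_neq0.

Lemma coefs1 n : coefs (1 : fps R) n = (n == 0)%N%:R. Proof. by []. Qed.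
Lemma coefsM f g n :
  coefs (f * g) n = \sum_(i < n.+1) coefs f i * coefs g (n - i)%N.
Proof. by []. Qed.

Definition fpsX : fps R := Fps (fun n => (n == 1)%N%:R).

(** [f(g(t))]; it is meaningful only when [g] has no constant term, in which
    case [g ^+ i] does not contribute in degree [n < i]. *)
Definition fps_comp f g : fps R :=
  Fps (fun n => \sum_(i < n.+1) coefs f i * coefs (g ^+ i) n).

(** [f / t], for [f] without constant term. *)
Definition fps_divX f : fps R := Fps (fun n => coefs f n.+1).

Lemma fps_divXK f : coefs f 0 = 0 -> fpsX * fps_divX f = f.
Proof.
move=> f0; apply/fpsP => -[|n].
  by rewrite coefsM big_ord_recl big_ord0 /= mul0r addr0 f0.
rewrite coefsM 2!big_ord_recl /= mul0r add0r mul1r subSS subn0 big1 ?addr0 //.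
by move=> i _; rewrite mul0r.
Qed.

Lemma coefs_expr_lt g i n : coefs g 0 = 0 -> (n < i)%N ->
  coefs (g ^+ i) n = 0.
Proof.
move=> g0; elim: i n => // i IHi n ni; rewrite exprS coefsM big1 // => -[j] /=.
case: j => [|j] jn _; first by rewrite g0 mul0r.
by rewrite IHi ?mulr0 // ltn_subLR ?(leq_trans ni) // addSn ltnS leq_addl.
Qed.

Lemma fps_geomK g : coefs g 0 = 0 ->
  fps_comp (Fps (fun=> 1)) g * (1 - g) = 1.
Proof.
move=> g0; apply/fpsP => n.
have coef_geom j : (j < n.+1)%N ->
    coefs (fps_comp (Fps (fun=> 1)) g) j = coefs (\sum_(i < n.+1) g ^+ i) j.
  move=> jn; rewrite coefs_sum /= (big_ord_widen n.+1 (fun i => 1 * coefs (g ^+ i) j)) //.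
  rewrite [RHS](bigID (fun i : 'I__ => (i < j.+1)%N)) /= [X in _ = _ + X]big1.
    by rewrite addr0; apply: eq_bigr => i _; rewrite mul1r.
  by move=> i; rewrite -leqNgt => ji; rewrite coefs_expr_lt.
have -> : coefs (fps_comp (Fps (fun=> 1)) g * (1 - g)) n
        = coefs ((\sum_(i < n.+1) g ^+ i) * (1 - g)) n.
  by rewrite !coefsM; apply: eq_bigr => i _; rewrite coef_geom.
have -> : (\sum_(i < n.+1) g ^+ i) * (1 - g) = 1 - g ^+ n.+1.
  by rewrite mulrC -opprB -[RHS]opprB subrX1 mulNr.
by rewrite coefsB coefs_expr_lt ?subr0.
Qed.

End ComRing.

Arguments fpsX {R}.

Definition fps_map (R S : Type) (u : R -> S) (f : fps R) : fps S :=
  Fps (fun n => u (coefs f n)).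

Section UnitRing.
Variable R : comUnitRingType.
Implicit Types f g : fps R.

Definition fps_unit : pred (fps R) := fun f => coefs f 0 \is a GRing.unit.

(** With [c] the constant term of [f],
    [1 / f = c^-1 * \sum_i (1 - c^-1 * f) ^+ i]. *)
Definition fps_inv f : fps R :=
  if fps_unit f then
    let c := Fps (fun n => (coefs f 0)^-1 * (n == 0)%N%:R) in
    c * fps_comp (Fps (fun=> 1)) (1 - c * f)
  else f.

Fact fps_mulVf : {in fps_unit, left_inverse 1 fps_inv *%R}.
Proof.
move=> f fU; rewrite /fps_inv ifT //=.
set c := Fps _; rewrite [c * _]mulrC -mulrA.
rewrite -[X in _ * X](subKr 1) fps_geomK // coefsB coefsM big_ord_recl big_ord0.
by rewrite /= mulr1 addr0 mulVr ?subrr.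
Qed.

Fact fps_intro_unit f g : g * f = 1 -> fps_unit f.
Proof.
move=> /(congr1 (fun h => coefs h 0)).
rewrite coefsM big_ord_recl big_ord0 addr0 /= => gf1.
by apply/unitrPr; exists (coefs g 0); rewrite mulrC.
Qed.

Fact fps_inv_out : {in [predC fps_unit], fps_inv =1 id}.
Proof. by move=> f; rewrite inE /fps_inv => /negbTE fU; rewrite ifF. Qed.

HB.instance Definition _ := GRing.ComNzRing_hasMulInverse.Build (fps R)
  fps_mulVf fps_intro_unit fps_inv_out.

Lemma fps_unitE f : (f \is a GRing.unit) = (coefs f 0 \is a GRing.unit).
Proof. by []. Qed.

End UnitRing.

Section MixedPolynomials.
Variable F : numFieldType.

(** [log(1+t)] *)
Definition log1p : fps F :=
  Fps (fun n => if n is n'.+1 then (-1) ^+ n' / n%:R else 0).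

(** [t / log(1+t)]: the quotient cannot be taken literally in the ring of power
    series, where [log(1+t)] is not invertible, but [log(1+t) / t] is. *)
Definition X_div_log1p : fps F := (fps_divX log1p)^-1.

Lemma X_div_log1pK : X_div_log1p * log1p = fpsX.
Proof.
rewrite -[X in _ * X](@fps_divXK _ log1p) // mulrCA mulVr ?mulr1 //.
by rewrite fps_unitE /= expr0 mul1r invr1 unitr1.
Qed.

Definition Lif (k : int) : fps F := Fps (fun n => (n`!%:R * n.+1%:R ^ k)^-1).

(** The binomial series [(1+t)^x], with the indeterminate ['X] for [x]. *)
Definition binomial_series : fps {poly F} :=
  Fps (fun n => (n`!%:R)^-1 *: \prod_(i < n) ('X - i%:R%:P)).

Lemma binomial_series_unit : binomial_series \is a GRing.unit.
Proof. by rewrite fps_unitE /= big_ord0 invr1 scale1r unitr1. Qed.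

Lemma binomial_series_nat N :
  fps_map (fun p => p.[N%:R]) binomial_series = (1 + fpsX) ^+ N.
Proof.
have coefsXn i n : coefs (fpsX ^+ i : fps F) n = (n == i)%:R.
  elim: i n => [|i IHi] [|n] //; rewrite exprS coefsM.
    by rewrite big_ord_recl big_ord0 /= mul0r addr0.
  rewrite 2!big_ord_recl /= mul0r add0r mul1r subSS subn0 big1 ?addr0 ?IHi //.
  by move=> j _; rewrite mul0r.
apply/fpsP => n; rewrite addrC exprDn coefs_sum /= hornerZ horner_prod.
have -> : \prod_(i < n) ('X - i%:R%:P).[N%:R] = (N ^_ n)%:R :> F.
  elim: n => [|n IHn]; first by rewrite big_ord0.
  rewrite big_ord_recr /= IHn hornerXsubC ffactnSr natrM.
  case: (leqP n N) => nN; first by rewrite natrB.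
  by rewrite ffact_small // !mul0r.
rewrite -bin_ffact natrM mulrCA mulVf ?mulr1; last first.
  by rewrite pnatr_eq0 -lt0n fact_gt0.
under eq_bigr do rewrite expr1n mulr1.
have coefsMn (f : fps F) j : coefs (f *+ j) n = coefs f n *+ j.
  by elim: j => // j IHj; rewrite !mulrS coefsD IHj.
under eq_bigr do rewrite coefsMn coefsXn.
case: (leqP n N) => nN.
  have nN1 : (N - n < N.+1)%N by rewrite ltnS leq_subr.
  rewrite (bigD1 (Ordinal nN1)) //= subKn // eqxx bin_sub // big1 ?addr0 // => i iN.
  have /negbTE-> : n != (N - i)%N; last by rewrite mul0rn.
  apply: contra iN => /eqP ni; apply/eqP/val_inj => /=.
  by rewrite ni subKn // -ltnS ltn_ord.
rewrite bin_small // big1 // => i _.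
by rewrite gtn_eqF ?mul0rn // (leq_ltn_trans (leq_subr _ _) nN).
Qed.

Definition A_gen (r k : int) : fps {poly F} :=
  fps_map polyC (X_div_log1p ^ r * fps_comp (Lif k) log1p) / binomial_series.

Definition A_poly (r k : int) (n : nat) : {poly F} :=
  n`!%:R *: coefs (A_gen r k) n.

Definition A_num (r k : int) (n : nat) : F := (A_poly r k n).[0].

End MixedPolynomials.

(** Signed Stirling numbers of the first kind. *)
Definition S1 (n m : nat) : int := (\prod_(i < n) ('X - i%:R%:P) : {poly int})`_m.

(* Main.v *)
(** Write [L = log(1+t)], [U = t/L] and [G = U^r Lif_k(L)]. Since
    [L^m/m!] is the exponential generating function of [S1(-, m)], the left-hand
    side is [n! [t^n] (L^m/m! G) = (n-1)! [t^(n-1)] (L^m/m! G)']. The product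
    rule, together with [U' = U/(1+t) (1 + U (L-t)/t^2)] and
    [t Lif_k'(t) = Lif_(k-1)(t) - Lif_k(t)], splits this derivative into the
    four sums on the right; a factor [1/(1+t)] is evaluation at [x = 1]. *)
Require Import Defs.
From mathcomp Require Import all_boot all_order all_algebra.
From mathcomp Require Import reals complex.
From mathcomp Require Import ring.
Import GRing.Theory Num.Theory.
Local Open Scope ring_scope.

(** * Calculus of formal power series: derivation, composition, exponential generating functions *)

Section PowerSeries.
Context {F : numFieldType}.
Implicit Types f g h : fps F.

Definition fpsC (c : F) : fps F := Fps (fun n => c * (n == 0)%N%:R).

Lemma coefs_fpsCM c f n : coefs (fpsC c * f) n = c * coefs f n.
Proof.
rewrite coefsM big_ord_recl /= mulr1 subn0 big1 ?addr0 // => i _.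
by rewrite mulr0 mul0r.
Qed.

Lemma coefs_fpsXMS f n : coefs (fpsX * f) n.+1 = coefs f n.
Proof.
rewrite coefsM 2!big_ord_recl /= mul0r add0r mul1r subSS subn0 big1 ?addr0 //.
by move=> i _; rewrite mul0r.
Qed.

Lemma coefs_fpsXM0 f : coefs (fpsX * f) 0 = 0.
Proof. by rewrite coefsM big_ord_recl big_ord0 /= mul0r addr0. Qed.

Lemma fpsX_inj f g : fpsX * f = fpsX * g -> f = g.
Proof.
by move=> fg; apply/fpsP => n; rewrite -2!(coefs_fpsXMS _ n) fg.
Qed.

Lemma coefs_intrM (z : int) f n : coefs (z%:~R * f) n = z%:~R * coefs f n.
Proof.
suff H (j : nat) : coefs (j%:R * f) n = j%:R * coefs f n.
  case: z => j; first exact: H.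
  by rewrite NegzE !mulrNz !mulNr coefsN -[_%:~R in LHS]pmulrn H.
elim: j => [|j IHj]; first by rewrite !mul0r.
by rewrite -!natr1 !mulrDl coefsD IHj !mul1r.
Qed.

Lemma coefs_natrM (j : nat) f n : coefs (j%:R * f) n = j%:R * coefs f n.
Proof. exact: (coefs_intrM j). Qed.

Definition fps_deriv f : fps F := Fps (fun n => n.+1%:R * coefs f n.+1).

Lemma coefs_deriv f n : coefs (fps_deriv f) n = n.+1%:R * coefs f n.+1.
Proof. by []. Qed.

Lemma coefs_fpsX_deriv f n : coefs (fpsX * fps_deriv f) n = n%:R * coefs f n.
Proof. by case: n => [|n]; rewrite ?coefs_fpsXM0 ?mul0r // coefs_fpsXMS. Qed.

Lemma fps_derivD f g : fps_deriv (f + g) = fps_deriv f + fps_deriv g.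
Proof. by apply/fpsP => n; rewrite /= mulrDr. Qed.

Lemma fps_derivM f g :
  fps_deriv (f * g) = fps_deriv f * g + f * fps_deriv g.
Proof.
apply/fpsP => n; rewrite coefsD [LHS]/=.
(* The weight [n.+1] is split as [i + (n.+1 - i)], one summand for each factor; the end terms
   [i = 0] and [i = n.+1] then drop out. *)
transitivity (\sum_(i < n.+2) (i%:R * coefs f i * coefs g (n.+1 - i)
    + coefs f i * ((n.+1 - i)%:R * coefs g (n.+1 - i)))).
  rewrite mulr_sumr; apply: eq_bigr => i _.
  have {1}-> : n.+1 = (i + (n.+1 - i))%N by rewrite subnKC // -ltnS.
  by rewrite natrD; ring.
rewrite big_split /=; congr (_ + _).
  rewrite big_ord_recl /= !mul0r add0r; apply: eq_bigr => i _.
  by rewrite /= subSS.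
rewrite big_ord_recr /= subnn mul0r mulr0 addr0; apply: eq_bigr => i _ /=.
by rewrite subSn // -ltnS.
Qed.

Lemma fps_deriv1 : fps_deriv 1 = 0.
Proof. by apply/fpsP => n /=; rewrite mulr0. Qed.

Lemma fps_derivX : fps_deriv fpsX = 1.
Proof. by apply/fpsP => -[|n] /=; rewrite ?mulr1 ?mulr0. Qed.

Lemma fps_derivC c : fps_deriv (fpsC c) = 0.
Proof. by apply/fpsP => n /=; rewrite !mulr0. Qed.

Lemma fps_deriv_sum (I : Type) (s : seq I) (E : I -> fps F) :
  fps_deriv (\sum_(i <- s) E i) = \sum_(i <- s) fps_deriv (E i).
Proof.
apply: (big_morph fps_deriv fps_derivD).
by apply/fpsP => n /=; rewrite mulr0.
Qed.

Lemma fps_derivXn f n :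
  fps_deriv (f ^+ n.+1) = n.+1%:R * f ^+ n * fps_deriv f.
Proof.
elim: n => [|n IHn]; first by rewrite expr0 mulr1 mul1r.
by rewrite exprS fps_derivM IHn exprS -[in RHS]natr1; ring.
Qed.

Lemma mul_fps_derivXn f n :
  f * fps_deriv (f ^+ n) = n%:R * f ^+ n * fps_deriv f.
Proof.
case: n => [|n]; first by rewrite fps_deriv1 mulr0 !mul0r.
by rewrite fps_derivXn exprS; ring.
Qed.

(** The extra factor [f] avoids the exponent [z - 1]. Negative exponents are reduced to positive
    ones by differentiating [f ^+ n.+1 * g = 1]. *)
Lemma mul_fps_derivXz f (z : int) : f \is a GRing.unit ->
  f * fps_deriv (f ^ z) = z%:~R * f ^ z * fps_deriv f.
Proof.
move=> fU; case: z => n; first exact: mul_fps_derivXn.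
have fnU : f ^+ n.+1 \is a GRing.unit by rewrite unitrX.
rewrite NegzE -exprnN mulrNz; set g := _ ^- _.
have fg1 : f ^+ n.+1 * g = 1 by rewrite divrr.
have := congr1 fps_deriv fg1.
rewrite fps_derivM fps_deriv1 => /(congr1 (fun h => f * g * h)) fg'.
have mul_fn := mul_fps_derivXn f n.+1.
rewrite -[_%:~R]pmulrn.
transitivity (f ^+ n.+1 * g * (f * fps_deriv g)); first by rewrite fg1 mul1r.
apply/eqP; rewrite -subr_eq0; apply/eqP.
(* The difference of the two sides is a combination of three expressions known to vanish: the
   differentiated relation, the power rule for [f ^+ n.+1], and [1 - f ^+ n.+1 * g]. *)
transitivity (f * g * (fps_deriv (f ^+ n.+1) * g + f ^+ n.+1 * fps_deriv g)
   - g * g * (f * fps_deriv (f ^+ n.+1) - n.+1%:R * f ^+ n.+1 * fps_deriv f)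
   + (1 - f ^+ n.+1 * g) * (n.+1%:R * g * fps_deriv f)); first by ring.
by rewrite fg' mul_fn fg1 !subrr !mulr0 mul0r subrr addr0.
Qed.

Lemma fps_deriv_inj f g :
  coefs f 0 = coefs g 0 -> fps_deriv f = fps_deriv g -> f = g.
Proof.
move=> fg0 fg'; apply/fpsP => -[//|n].
have /mulfI : n.+1%:R != 0 :> F by rewrite pnatr_eq0.
by apply; exact: (congr1 (fun h => coefs h n) fg').
Qed.

(** As [g ^+ i] starts in degree at least [i], the terms with [n < i] contribute nothing. One
    polynomial in [g] thus serves for all degrees below [N]. *)
Lemma coefs_fps_comp N h g n : coefs g 0 = 0 -> (n < N)%N ->
  coefs (fps_comp h g) n = coefs (\sum_(i < N) fpsC (coefs h i) * g ^+ i) n.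
Proof.
move=> g0 nN; rewrite coefs_sum [LHS]/=.
under [RHS]eq_bigr do rewrite coefs_fpsCM.
rewrite (big_ord_widen N (fun i => coefs h i * coefs (g ^+ i) n)) //.
rewrite [RHS](bigID (fun i : 'I__ => (i < n.+1)%N)) /= [X in _ = _ + X]big1.
  by rewrite addr0.
by move=> i; rewrite -leqNgt => ni; rewrite coefs_expr_lt // mulr0.
Qed.

Lemma eq_coefsM N f g h : (forall n, (n <= N)%N -> coefs g n = coefs h n) ->
  coefs (f * g) N = coefs (f * h) N.
Proof.
by move=> gh; rewrite !coefsM; apply: eq_bigr => i _; rewrite gh ?leq_subr.
Qed.

Lemma fps_compB f g h :
  fps_comp (f - g) h = fps_comp f h - fps_comp g h.
Proof.
apply/fpsP => n /=; rewrite -sumrB; apply: eq_bigr => i _.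
by rewrite mulrBl.
Qed.

(* The chain rule, multiplied by [g] so that no [g ^+ i.-1] occurs. *)
Lemma mul_fps_deriv_comp h g : coefs g 0 = 0 ->
  g * fps_deriv (fps_comp h g)
  = fps_comp (fpsX * fps_deriv h) g * fps_deriv g.
Proof.
move=> g0; apply/fpsP => n.
(* Differentiation looks one degree ahead, so the truncation must be right up to degree [n.+1],
   whence [n.+2] terms. *)
rewrite (eq_coefsM _ _ _
  (fps_deriv (\sum_(i < n.+2) fpsC (coefs h i) * g ^+ i))); last first.
  by move=> i ni; rewrite !coefs_deriv (coefs_fps_comp n.+2) ?ltnS.
rewrite [_ * fps_deriv g]mulrC [RHS](eq_coefsM _ _ _
  (\sum_(i < n.+2) fpsC (coefs (fpsX * fps_deriv h) i) * g ^+ i)); last first.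
  by move=> i ni; rewrite (coefs_fps_comp n.+2) // ltnS leqW.
rewrite fps_deriv_sum !mulr_sumr !coefs_sum; apply: eq_bigr => i _.
rewrite fps_derivM fps_derivC mul0r add0r coefs_fpsX_deriv.
rewrite mulrCA mul_fps_derivXn [in RHS]mulrCA !coefs_fpsCM.
by rewrite -mulrA coefs_natrM mulrA [fps_deriv g * _]mulrC [_%:R * _]mulrC.
Qed.

Definition egf (u : nat -> F) : fps F := Fps (fun n => u n / n`!%:R).

Lemma fact_neq0 n : n`!%:R != 0 :> F.
Proof. by rewrite pnatr_eq0 -lt0n fact_gt0. Qed.

Lemma egfE (u : nat -> F) n : u n = n`!%:R * coefs (egf u) n.
Proof. by rewrite /= mulrC divfK ?fact_neq0. Qed.

Lemma coefs_egfM (u v : nat -> F) n :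
  n`!%:R * coefs (egf u * egf v) n
  = \sum_(0 <= i < n.+1) 'C(n, i)%:R * (u i * v (n - i)%N).
Proof.
rewrite big_mkord coefsM mulr_sumr; apply: eq_bigr => i _ /=.
have iN : (i <= n)%N by rewrite -ltnS.
rewrite -(bin_fact iN) !natrM.
by field; rewrite !fact_neq0.
Qed.

End PowerSeries.

(** * Ring morphisms acting on coefficients *)

Section MapSeries.
Context {R S : comNzRingType}.
Variable u : {rmorphism R -> S}.

Lemma fps_mapM f g : fps_map u (f * g) = fps_map u f * fps_map u g.
Proof.
apply/fpsP => n; rewrite /= rmorph_sum; apply: eq_bigr => i _.
by rewrite rmorphM.
Qed.

End MapSeries.

(** * Stirling numbers of the first kind and powers of log(1+t) *)

Section Stirling.
Context {F : numFieldType}.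
Local Notation L := (log1p F).
Local Notation P := (1 + fpsX : fps F).

Lemma mul_deriv_log1p : P * fps_deriv L = 1.
Proof.
apply/fpsP => n; rewrite mulrDl mul1r coefsD.
have dL j : coefs (fps_deriv L) j = (-1) ^+ j.
  by rewrite /= mulrC divfK // pnatr_eq0.
case: n => [|n]; first by rewrite coefs_fpsXM0 dL addr0.
by rewrite coefs_fpsXMS !dL exprS mulN1r addNr.
Qed.

Lemma addr1X_unit : P \is a GRing.unit.
Proof. by rewrite fps_unitE /= addr0 unitr1. Qed.

Lemma S1_0 n : S1 n.+1 0 = 0.
Proof.
by rewrite /S1 big_ord_recl /= -horner_coef0 hornerM !hornerE ?mul0r.
Qed.

Lemma S1_SS n m : S1 n.+1 m.+1 = S1 n m - n%:R * S1 n m.+1.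
Proof.
rewrite /S1 big_ord_recr /= mulrBr coefB coefMX coefMC /=.
by rewrite mulrC.
Qed.

Lemma S1_small n m : (n < m)%N -> S1 n m = 0.
Proof.
by move=> nm; rewrite /S1 nth_default // size_prod_XsubC
  -[index_enum _]enumT size_enum_ord.
Qed.

(** Induction on [m]: for positive exponents both sides have no constant term and satisfy (1+t)
    f_(m+1)' = (m+1) f_m, which on the Stirling side is the recurrence [S1_SS]. *)
Lemma egf_S1 m :
  egf (fun n => (m`!%:R * (S1 n m)%:~R : F)) = L ^+ m.
Proof.
elim: m => [|m IHm].
  apply/fpsP => -[|n]; rewrite expr0 /=.
    by rewrite /S1 big_ord0 coefC /= !mulr1 divr1.
  by rewrite S1_0 mulr0 mul0r.
apply: fps_deriv_inj.
  rewrite exprS coefsM big_ord_recl big_ord0 /= mul0r addr0.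
  by rewrite S1_small // mulr0 mul0r.
apply: (mulrI addr1X_unit).
rewrite fps_derivXn mulrCA mul_deriv_log1p mulr1 -IHm.
apply/fpsP => n; rewrite coefs_natrM mulrDl mul1r coefsD coefs_fpsX_deriv /=.
rewrite S1_SS !factS !natrM rmorphB rmorphM rmorph_nat /=.
by field; rewrite fact_neq0 nat1r pnatr_eq0.
Qed.

(** For [l > n - m] the Stirling number vanishes, so the sum is a full binomial convolution, hence a
    coefficient of a product. *)
Lemma sum_bin_S1 (v : nat -> F) n m : (m <= n)%N ->
  \sum_(0 <= l < (n - m).+1) 'C(n, l)%:R * (S1 (n - l) m)%:~R * v l
  = n`!%:R / m`!%:R * coefs (egf v * L ^+ m) n.
Proof.
move=> mn; rewrite -egf_S1 mulrAC coefs_egfM.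
rewrite [in RHS](big_cat_nat _ (n := (n - m).+1)) //=;
  last by rewrite ltnS leq_subr.
rewrite [X in _ = (_ + X) / _]big1_seq ?addr0 => [|l]; last first.
  rewrite mem_index_iota => /andP[_ /andP[nml ln]].
  by rewrite S1_small ?mulr0 // ltn_subCl.
rewrite mulr_suml; apply: eq_bigr => l _.
by field; rewrite fact_neq0.
Qed.

End Stirling.

(** * The generating functions of the A_n^(r,k) and the comparison of coefficients *)

Section Generating.
Context {F : numFieldType}.
Local Notation L := (log1p F).
Local Notation P := (1 + fpsX : fps F).
Local Notation U := (X_div_log1p F).

Definition A_num_gen (r k : int) : fps F := U ^ r * fps_comp (Lif F k) L.

(** At a natural number [c] the binomial series becomes the power (1+t)^c; only [c = 0] and [c = 1]
    are used below. *)
Lemma egf_A_poly r k (c : nat) :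
  egf (fun l => (A_poly F r k l).[c%:R]) * P ^+ c = A_num_gen r k.
Proof.
pose u := horner_eval (c%:R : F).
have -> : egf (fun l => (A_poly F r k l).[c%:R]) = fps_map u (A_gen F r k).
  apply/fpsP => n /=; rewrite /u /horner_eval /A_poly hornerZ mulrAC.
  by rewrite divff ?fact_neq0 // mul1r.
rewrite -binomial_series_nat -(fps_mapM u) /A_gen divrK
  ?binomial_series_unit //.
by apply/fpsP => n; rewrite /= /u /horner_eval hornerC.
Qed.

(* [(log(1+t) - t) / t^2] *)
Definition log1p_rem2 : fps F := Fps (fun j => (-1) ^+ j.+1 / j.+2%:R).

Lemma X_div_log1p_unit : U \is a GRing.unit.
Proof.
by rewrite unitrV fps_unitE /= expr0 mul1r invr1 unitr1.
Qed.

(** Let V = L/t = 1/U and W = [log1p_rem2], so V = 1 + tW. Differentiating tV = L gives (1+t)V' =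
    -(V + W), and UV = 1 gives U' = -U^2 V'. *)
Lemma mul_deriv_X_div_log1p : P * fps_deriv U = U + U ^+ 2 * log1p_rem2.
Proof.
pose V := fps_divX L.
have UV : U * V = 1.
  by rewrite /X_div_log1p mulVr // -unitrV; exact: X_div_log1p_unit.
have VE : V = 1 + fpsX * log1p_rem2.
  apply/fpsP => -[|n].
    by rewrite coefsD coefs_fpsXM0 /= expr0 mul1r invr1 addr0.
  by rewrite coefsD coefs_fpsXMS /= add0r.
have XV : fpsX * V = L by apply: fps_divXK.
have := congr1 fps_deriv XV; rewrite fps_derivM fps_derivX mul1r.
move=> /(congr1 ( *%R P)); rewrite mul_deriv_log1p => dV.
have {}dV : P * fps_deriv V = - (V + log1p_rem2).
  have XW : fpsX * log1p_rem2 = V - 1 by rewrite VE addrC addKr.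
  apply: fpsX_inj.
  transitivity (P * (V + fpsX * fps_deriv V) - P * V); first by ring.
  by rewrite dV mulrN mulrDr XW; ring.
have := congr1 fps_deriv UV; rewrite fps_derivM fps_deriv1 => dUV.
transitivity (P * U * (fps_deriv U * V + U * fps_deriv V)
  - U ^+ 2 * (P * fps_deriv V) + P * fps_deriv U * (1 - U * V)); first by ring.
rewrite dUV dV UV subrr !mulr0 add0r addr0.
transitivity (U * (U * V) + U ^+ 2 * log1p_rem2); first by ring.
by rewrite UV mulr1.
Qed.

Lemma mul_deriv_X_div_log1pXz (r : int) :
  P * fps_deriv (U ^ r) = r%:~R * (U ^ r + U ^ (r + 1) * log1p_rem2).
Proof.
apply: (mulrI X_div_log1p_unit); rewrite mulrCA mul_fps_derivXz ?X_div_log1p_unit //.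
rewrite mulrCA mul_deriv_X_div_log1p exprzDr ?X_div_log1p_unit // expr1z.
by set Ur := U ^ r; ring.
Qed.

(** In degree [n] the operator t d/dt multiplies by n = (n+1) - 1, and the factor n+1 lowers [k] by
    one. *)
Lemma mulX_deriv_Lif k :
  fpsX * fps_deriv (Lif F k) = Lif F (k - 1) - Lif F k.
Proof.
apply/fpsP => n; rewrite coefsB coefs_fpsX_deriv.
have n0 : n.+1%:R != 0 :> F by rewrite pnatr_eq0.
rewrite /= expfzDr // -exprnN expr1 -natr1.
rewrite -natr1 in n0.
by field; rewrite n0 fact_neq0 expfz_neq0.
Qed.

(** Here [a r k] stands for the generating function at x = 1. The coefficient [m] of the last term
    is [m.+1], from the derivative of [L ^+ m.+1], minus the 1 coming from -Lif_k in
    [mulX_deriv_Lif]. *)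
Lemma deriv_A_num_gen_logX (r k : int) m (a : int -> int -> fps F) :
    (forall r k, a r k * P = A_num_gen r k) ->
  fps_deriv (A_num_gen r k * L ^+ m.+1) =
  r%:~R * (log1p_rem2 * a (r + 1) k * L ^+ m.+1) + r%:~R * (a r k * L ^+ m.+1)
  + a r (k - 1) * L ^+ m + m%:R * (a r k * L ^+ m).
Proof.
move=> aP; apply: (mulrI addr1X_unit).
have dL := mul_deriv_log1p.
have dU := mul_deriv_X_div_log1pXz r.
have dLif := mul_fps_deriv_comp (Lif F k) L erefl.
rewrite mulX_deriv_Lif fps_compB in dLif.
transitivity (r%:~R * (log1p_rem2 * (a (r + 1) k * P) * L ^+ m.+1)
  + r%:~R * (a r k * P * L ^+ m.+1) + a r (k - 1) * P * L ^+ m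
  + m%:R * (a r k * P * L ^+ m)); last by ring.
rewrite !aP /A_num_gen !fps_derivM fps_derivXn.
set f := fps_comp (Lif F k) L in dLif *.
set f' := fps_comp (Lif F (k - 1)) L in dLif *.
set Ur := U ^ r in dU *.
(* One factor [L] of [L ^+ m.+1] is attached to [fps_deriv f], since the chain rule [dLif] is stated
   for that product. *)
transitivity ((P * fps_deriv Ur) * f * L ^+ m.+1
  + Ur * L ^+ m * (P * (L * fps_deriv f))
  + Ur * f * m.+1%:R * L ^+ m * (P * fps_deriv L)).
  by rewrite exprS; ring.
rewrite dLif dU [P * (_ * _)]mulrCA dL -natr1 -/Ur.
by ring.
Qed.

Lemma sum_bin_S1_A_num (r k : int) (n m : nat) :
  (1 <= m)%N -> (m <= n - 1)%N ->
  \sum_(0 <= l < (n - m).+1)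
     'C(n, l)%:R * (S1 (n - l) m)%:~R * A_num F r k l
  = r%:~R * (\sum_(0 <= l < (n - 1 - m).+1) \sum_(0 <= a < l.+1)
       (-1) ^+ (l - a + 1) * ((l - a)`!%:R / (l - a + 2)%:R)
       * 'C(n - 1, l)%:R * 'C(l, a)%:R
       * (S1 (n - 1 - l) m)%:~R * (A_poly F (r + 1) k a).[1])
  + r%:~R * (\sum_(0 <= l < (n - 1 - m).+1)
       'C(n - 1, l)%:R * (S1 (n - l - 1) m)%:~R * (A_poly F r k l).[1])
  + m%:R^-1 * (\sum_(0 <= l < (n - m).+1)
       'C(n - 1, l)%:R * (S1 (n - l - 1) (m - 1))%:~R
       * (A_poly F r (k - 1) l).[1])
  + (1 - m%:R^-1) * (\sum_(0 <= l < (n - m).+1)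
       'C(n - 1, l)%:R * (S1 (n - l - 1) (m - 1))%:~R
       * (A_poly F r k l).[1]).
Proof.
case: m => // m _; case: n => // n; rewrite subn1 /= => mn.
under [in X in _ = _ + X + _ + _]eq_bigr do rewrite subnAC subn1 /=.
under [in X in _ = _ + X + _]eq_bigr do rewrite subnAC subn1 /=.
under [in X in _ = _ + X]eq_bigr do rewrite subnAC subn1 /=.
rewrite subn1 /= subSS.
pose a r k : fps F := egf (fun l => (A_poly F r k l).[1]).
have aP r' k' : a r' k' * (1 + fpsX) = A_num_gen r' k'.
  by rewrite -(egf_A_poly r' k' 1).
(* The inner sum of the double sum is a binomial convolution with the sequence whose exponential
   generating function is [log1p_rem2]. *)
pose w l := \sum_(0 <= b < l.+1) 'C(l, b)%:R *
  ((A_poly F (r + 1) k b).[1] * ((-1) ^+ (l - b + 1) *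
    ((l - b)`!%:R / (l - b + 2)%:R))).
have egf_w : egf w = log1p_rem2 * a (r + 1) k.
  have WE : log1p_rem2 = egf (fun j => (-1) ^+ (j + 1) * (j`!%:R / (j + 2)%:R)) :> fps F.
    apply/fpsP => j /=; rewrite addn1 addn2.
    by field; rewrite fact_neq0 -natrD pnatr_eq0.
  rewrite mulrC WE; apply/fpsP => l; apply: (mulfI (fact_neq0 l)).
  by rewrite -egfE coefs_egfM.
rewrite [X in _ = _ * X + _ + _ + _](eq_bigr
  (fun l => 'C(n, l)%:R * (S1 (n - l) m.+1)%:~R * w l));
  last first.
  move=> l _; rewrite /w mulr_sumr; apply: eq_bigr => b _; ring.
have mn' := ltnW mn.
rewrite -[in LHS]subSS [LHS]sum_bin_S1; last exact: leqW.
rewrite !sum_bin_S1 //.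
have <- : A_num_gen r k = egf (A_num F r k) by rewrite -(egf_A_poly r k 0) expr0 mulr1.
have := congr1 (fun f => coefs f n) (deriv_A_num_gen_logX r k m a aP).
rewrite !coefsD !coefs_intrM coefs_natrM coefs_deriv -egf_w => eq_coefs.
rewrite !factS !natrM.
(* With n and m shifted down by one, the factor [n.+1] turns degree [n.+1] into degree [n] of the
   derivative. The common factor is n!/(m+1)!, because 1 - 1/(m+1) = m/(m+1). *)
transitivity (n`!%:R / (m.+1%:R * m`!%:R)
  * (n.+1%:R * coefs (A_num_gen r k * log1p F ^+ m.+1) n.+1)).
  by field; rewrite fact_neq0 nat1r pnatr_eq0.
rewrite eq_coefs /a.
by field; rewrite fact_neq0 nat1r pnatr_eq0.
Qed.

End Generating.

Theorem theorem2p5 (R : realType) (r k : int) (n m : nat) :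
  (1 <= m)%N -> (m <= n - 1)%N ->
  \sum_(0 <= l < (n - m).+1)
     'C(n, l)%:R * (S1 (n - l) m)%:~R * A_num R[i] r k l
  = r%:~R * (\sum_(0 <= l < (n - 1 - m).+1) \sum_(0 <= a < l.+1)
       (-1) ^+ (l - a + 1) * ((l - a)`!%:R / (l - a + 2)%:R)
       * 'C(n - 1, l)%:R * 'C(l, a)%:R
       * (S1 (n - 1 - l) m)%:~R * (A_poly R[i] (r + 1) k a).[1])
  + r%:~R * (\sum_(0 <= l < (n - 1 - m).+1)
       'C(n - 1, l)%:R * (S1 (n - l - 1) m)%:~R * (A_poly R[i] r k l).[1])
  + m%:R^-1 * (\sum_(0 <= l < (n - m).+1)
       'C(n - 1, l)%:R * (S1 (n - l - 1) (m - 1))%:~R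
       * (A_poly R[i] r (k - 1) l).[1])
  + (1 - m%:R^-1) * (\sum_(0 <= l < (n - m).+1)
       'C(n - 1, l)%:R * (S1 (n - l - 1) (m - 1))%:~R
       * (A_poly R[i] r k l).[1]).
Proof. exact: sum_bin_S1_A_num. Qed.
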